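(* Let $n\ge 1$. The map $\sigma\mapsto \mathbf{C}(\sigma)$ defines a bijection between the set of smooth permutations in $S_n$ and the set of those downward closed subsets $A\subseteq \mathcal{C}^{2,3}$ that satisfy the following two conditions: (i) if $R_{i,j,l}\in A$ and $R_{i,k,l}^{-1}\in A$ for some $i,j,k,l$ with $i<j<l$ and $i<k<l$, then $T_{i,l}\in A$; (ii) whenever $T_{i,j},T_{j,k}\in A$ with $i<j<k$, at least one of $R_{i,j,k}$ and $R_{i,j,k}^{-1}$ belongs to $A$. The inverse bijection $A\mapsto \pi(A)$ is given by $$\pi(A)=\max\{\tau\in S_n:\mathbf{C}(\tau)=A\}=\max\{\tau\in S_n:\mathbf{C}_{\mathcal{T}}(\tau)=A\cap\mathcal{T},\ \mathbf{C}(\tau)\subseteq A\},$$ where the maxima are greatest elements with respect to the Bruhat order (in particular, these greatest elements exist).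
   Context: $S_n$ is the group of permutations of $[n]=\{1,\dots,n\}$ with the Bruhat order $\le$, i.e. $\tau\le\sigma$ iff $\#(\tau([i])\cap[j])\ge\#(\sigma([i])\cap[j])$ for all $i,j\in[n]$. $\mathcal{T}=\{T_{i,j}:1\le i<j\le n\}$ is the set of transpositions, $T_{i,j}$ interchanging $i$ and $j$. For $i<j<k$, $R_{i,j,k}$ is the $3$-cycle $i\mapsto j\mapsto k\mapsto i$. Put $\mathcal{C}^{2,3}=\mathcal{T}\cup\{R_{i,j,k},R_{i,j,k}^{-1}:1\le i<j<k\le n\}\subset S_n$. For $\sigma\in S_n$ let $\mathbf{C}_{\mathcal{T}}(\sigma)=\{\tau\in\mathcal{T}:\tau\le\sigma\}$ and $\mathbf{C}(\sigma)=\{\tau\in\mathcal{C}^{2,3}:\tau\le\sigma\}$. A subset $A\subseteq\mathcal{C}^{2,3}$ is downward closed if $\sigma\in A$, $\tau\in\mathcal{C}^{2,3}$, $\tau\le\sigma$ imply $\tau\in A$. Let $\ell(\sigma)=\#\{i<j:\sigma(i)>\sigma(j)\}$. A permutation $\sigma\in S_n$ is smooth if $\ell(\sigma)=\#\mathbf{C}_{\mathcal{T}}(\sigma)$ (it is known that this is equivalent to $\sigma$ avoiding the patterns $4231$ and $3412$). *)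

(* Defs.v *)
From mathcomp Require Import all_boot all_fingroup.

Set Implicit Arguments.
Unset Strict Implicit.
Unset Printing Implicit Defensive.

(* [n] = {1, ..., n} is encoded by 'I_n = {0, ..., n - 1}; the element i of [n]
   corresponds to i - 1. *)

Section Bruhat.

Variable n : nat.
Implicit Types (s t : 'S_n) (A : {set 'S_n}).

(* For i : 'I_n this has i + 1 elements, so that i ranging over 'I_n yields the
   initial segments [1], ..., [n]. *)
Definition initseg (i : 'I_n) : {set 'I_n} := [set x : 'I_n | x <= i].

Definition bruhat : rel 'S_n := fun t s =>
  [forall i : 'I_n, forall j : 'I_n,
     #|(t @: initseg i) :&: initseg j| >= #|(s @: initseg i) :&: initseg j|].

Definition transpositions : {set 'S_n} :=
  [set s | [exists i : 'I_n, exists j : 'I_n, (i < j) && (s == tperm i j)]].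

(* Products of permutations compose from left to right; see rcycleE. *)
Definition rcycle (i j k : 'I_n) : 'S_n := (tperm i j * tperm i k)%g.

Lemma rcycleE (i j k : 'I_n) : i < j -> j < k ->
  [/\ rcycle i j k i = j, rcycle i j k j = k, rcycle i j k k = i
    & forall x, x \notin [:: i; j; k] -> rcycle i j k x = x].
Proof.
move=> ltij ltjk; have ltik := ltn_trans ltij ltjk.
have neq (x y : 'I_n) : x < y -> (x == y = false) * (y == x = false).
  by move=> ltxy; rewrite -!val_eqE /= ltn_eqF // gtn_eqF.
have neqs := (neq _ _ ltij, neq _ _ ltjk, neq _ _ ltik).
split=> [|||x]; rewrite /rcycle ?permM ?permE /= ?neqs ?eqxx ?neqs //.
rewrite !inE !negb_or => /and3P[/negPf xi /negPf xj /negPf xk].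
by rewrite !(xi, xj, xk).
Qed.

Definition cycles23 : {set 'S_n} :=
  transpositions :|:
  [set s | [exists i : 'I_n, exists j : 'I_n, exists k : 'I_n,
     [&& i < j, j < k & (s == rcycle i j k) || (s == (rcycle i j k)^-1%g)]]].

Definition C_T s : {set 'S_n} := [set t in transpositions | bruhat t s].

Definition C_23 s : {set 'S_n} := [set t in cycles23 | bruhat t s].

Definition downward_closed A : Prop :=
  forall s t, s \in A -> t \in cycles23 -> bruhat t s -> t \in A.

Definition perm_length s : nat :=
  #|[set p : 'I_n * 'I_n | (p.1 < p.2) && (s p.1 > s p.2)]|.

Definition smooth s : Prop := perm_length s = #|C_T s|.

Definition cond_i A : Prop :=
  forall i j k l : 'I_n, i < j -> j < l -> i < k -> k < l ->
    rcycle i j l \in A -> (rcycle i k l)^-1%g \in A -> tperm i l \in A.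

Definition cond_ii A : Prop :=
  forall i j k : 'I_n, i < j -> j < k ->
    tperm i j \in A -> tperm j k \in A ->
    rcycle i j k \in A \/ (rcycle i j k)^-1%g \in A.

Definition admissible A : Prop :=
  [/\ A \subset cycles23, downward_closed A, cond_i A & cond_ii A].

Definition is_greatest (P : 'S_n -> Prop) s : Prop :=
  P s /\ forall t, P t -> bruhat t s.

End Bruhat.

(* Main.v *)
(* For a permutation s let M(a) = max {s x : x <= a} and let M' be the same
   function for s^-1. Then T_{a,b} <= s iff b <= min(M a, M' a), while
   R_{a,b,c} <= s iff b <= M a, c <= M b and c <= M' a, so the set C(s) is
   determined by the pair (M, M').

   Let K be the last point, and suppose s K <= s^-1 K (otherwise invert).
   Deleting the value K decreases the length by the number of transpositions
   T_{a,K} below s, so the length is at most #C_T(s), and s is smooth iff the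
   deleted permutation s1 is smooth and no transposition other than the T_{a,K}
   is lost. Induction along this deletion shows that a smooth s satisfies
     (S)  M' a <= M a implies M (M' a) = M a, and symmetrically,
   which gives (ii), that every pair satisfying (S) comes from a smooth s (the
   pair of s1 is the truncation of that of s), and that for smooth s, t <= s as
   soon as the functions of t are dominated by those of s. With (S) this
   domination follows from C_T(t) = C_T(s) and C(t) contained in C(s).

   Conversely A determines m a = max {b : T_{a,b} in A}, and (i), (ii) say that
   when a < m a < m (m a) exactly one of the two kinds of 3-cycles starting with
   a and m a occurs in A. If it is R^-1 put M a = M (m a) and M' a = m a, if it
   is R exchange the roles, and otherwise M a = M' a = m a; this pair satisfies
   (S) and its cycles are those of A. *)

Require Import Defs.
From mathcomp Require Import all_boot all_fingroup zify.

Set Implicit Arguments.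
Unset Strict Implicit.
Unset Printing Implicit Defensive.

Local Open Scope group_scope.
Local Open Scope nat_scope.

(** * Prefix maxima, ranks and inversions of permutations of nat *)

Definition pmax (f : nat -> nat) a := \max_(x < a.+1) f x.

Lemma pmax_ge f x a : x <= a -> f x <= pmax f a.
Proof.
move=> xa.
exact: (leq_bigmax (F := fun i : 'I_a.+1 => f i) (Ordinal (xa : x < a.+1))).
Qed.

Lemma pmax_le f a b : (forall x, x <= a -> f x <= b) -> pmax f a <= b.
Proof. by move=> H; apply/bigmax_leqP => i _; apply: H; have := ltn_ord i; lia. Qed.

Lemma pmax_ex f a : exists2 x, x <= a & f x = pmax f a.
Proof.
have [|i e] := eq_bigmax (fun i : 'I_a.+1 => f i); first by rewrite card_ord.
by exists i => //; have := ltn_ord i; lia.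
Qed.

Lemma pmax_mono f a b : a <= b -> pmax f a <= pmax f b.
Proof. by move=> ab; apply: pmax_le => x xa; apply: pmax_ge; lia. Qed.

Lemma eq_pmax f f' a : (forall x, x <= a -> f x = f' x) -> pmax f a = pmax f' a.
Proof. by move=> H; apply: eq_bigr => i _; apply: H; have := ltn_ord i; lia. Qed.

(** A permutation of the first [k] naturals, extended by the identity so that [k] can vary in
    inductions. Carrying the inverse [g] along turns inversion into an exchange of arguments. *)
Definition inverse_pair k (f g : nat -> nat) :=
  [/\ cancel f g, cancel g f & forall x, k <= x -> f x = x].

Definition ninv k (f : nat -> nat) :=
  \sum_(x < k) \sum_(y < k) ((x < y) && (f y < f x)).

(** Counts the transpositions T_{a,b} below the permutation, grouped by [a]; see [card_C_T]. *)
Definition ntransp k (f g : nat -> nat) :=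
  \sum_(a < k) (minn (pmax f a) (pmax g a) - a).

Definition brank (f : nat -> nat) i j := \sum_(x < i) (f x < j).

Lemma inverse_pair_sym k f g : inverse_pair k f g -> inverse_pair k g f.
Proof. by move=> [fK gK fx]; split=> // x kx; rewrite -{1}(fx x kx) fK. Qed.

Lemma inverse_pair_lt k f g x : inverse_pair k f g -> x < k -> f x < k.
Proof.
move=> [fK gK fx] xk; rewrite ltnNge; apply/negP => kf.
by have := fx _ kf; move/(can_inj fK) => e; rewrite e in kf; lia.
Qed.

(** Pigeonhole: [a + 1] distinct values cannot all be smaller than [a]. *)
Lemma pmax_id k f g a : inverse_pair k f g -> a <= pmax f a.
Proof.
move=> H; case: (ltnP a k) => ak; last first.
  by case: H => _ _ /(_ a ak) {1}<-; apply: pmax_ge.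
rewrite leqNgt; apply/negP => pa.
have fa (x : 'I_a.+1) : f x < a.
  by apply: leq_ltn_trans pa; apply: pmax_ge; have := ltn_ord x; lia.
have inj : injective (fun x : 'I_a.+1 => Ordinal (fa x)).
  case: H => fK _ _ x y [] /(can_inj fK) e; exact: val_inj.
by have := leq_card _ inj; rewrite !card_ord ltnn.
Qed.

Lemma pmax_lt k f g a : inverse_pair k f g -> a < k -> pmax f a < k.
Proof. by move=> H ak; have [x xa <-] := pmax_ex f a; apply: (inverse_pair_lt H);
  lia. Qed.

Lemma reindex_inverse_pair k f g (F : nat -> nat) : inverse_pair k f g ->
  \sum_(x < k) F x = \sum_(v < k) F (g v).
Proof.
move=> H; have H' := inverse_pair_sym H; case: (H) => fK gK _.
have lg (v : 'I_k) : g v < k by apply: (inverse_pair_lt H').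
have lf (v : 'I_k) : f v < k by apply: (inverse_pair_lt H).
rewrite (reindex (fun v : 'I_k => Ordinal (lg v))) //=.
by exists (fun v : 'I_k => Ordinal (lf v)) => v _; apply: val_inj => /=;
  rewrite ?gK ?fK.
Qed.

Lemma brankE k f i j : i <= k ->
  brank f i j = \sum_(x < k) ((x < i) && (f x < j)).
Proof.
move=> ik; rewrite /brank (big_ord_widen k (fun x => (f x < j : nat)) ik) big_mkcond.
by apply: eq_bigr => x _; case: (x < i).
Qed.

Lemma brank_sym k f g i j : inverse_pair k f g -> i <= k -> j <= k ->
  brank f i j = brank g j i.
Proof.
move=> H ik jk; rewrite (brankE _ _ ik) (brankE _ _ jk).
rewrite (reindex_inverse_pair (fun x => ((x < i) && (f x < j) : nat)) H).
by case: H => _ gK _; apply: eq_bigr => v _; rewrite gK andbC.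
Qed.

Lemma brank_max f i j : (brank f i.+1 j == i.+1) = (pmax f i < j).
Proof.
rewrite /brank.
have -> : (\sum_(x < i.+1) (f x < j) == i.+1) =
  (\sum_(x < i.+1) (f x < j) == \sum_(x < i.+1) 1).
  by rewrite sum1_card card_ord.
have := leqif_sum (I := 'I_i.+1) (P := predT) (C := fun x : 'I_i.+1 => f x < j)
  (E1 := fun x => (f x < j : nat)) (E2 := fun=> 1).
move=> [|_ ->]; first by move=> x _; split; case: (f x < j).
apply/forallP/idP => /= [H|H x].
  by have [y yi <-] := pmax_ex f i; apply: (H (Ordinal (yi : y < i.+1))).
by apply: leq_ltn_trans H; apply: pmax_ge; rewrite -ltnS.
Qed.

(** Both equalities mean that the rank at [(a + 1, a + 1)] is full, and this rank is the same for
    the inverse. *)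
Lemma pmax_fix k f g a : inverse_pair k f g -> a < k -> pmax f a = a -> pmax g a = a.
Proof.
move=> H ak e; have := brank_max f a a.+1;
  rewrite e ltnSn (brank_sym H ak ak) brank_max.
by have := pmax_id a (inverse_pair_sym H); lia.
Qed.

Lemma ninv_sym k f g : inverse_pair k f g -> ninv k f = ninv k g.
Proof.
move=> H; rewrite /ninv [RHS]exchange_big /=.
rewrite (reindex_inverse_pair (fun x => \sum_(y < k) ((x < y) && (f y < f x))) H).
apply: eq_bigr => v _.
rewrite (reindex_inverse_pair (fun y => ((g v < y) && (f y < f (g v)) : nat)) H).
by case: H => _ gK _; apply: eq_bigr => u _; rewrite !gK andbC.
Qed.

Lemma ntransp_sym k f g : ntransp k f g = ntransp k g f.
Proof. by apply: eq_bigr => a _; rewrite minnC. Qed.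

Lemma sum_geq K p : \sum_(y < K) (p <= y) = K - p.
Proof. by elim: K => [|K IH]; rewrite ?big_ord0 // big_ord_recr /= IH; lia. Qed.

(** * Deleting the largest value *)

Definition del_pos K p (f : nat -> nat) x := if x < K then f (bump p x) else x.
(** The same deletion seen on the inverse: the argument [K] goes, and values above [p] move down by
    one. *)
Definition del_val K p (g : nat -> nat) v := if v < K then unbump p (g v) else v.

Section Deletion.
Variables (K : nat) (f g : nat -> nat).
Hypothesis H : inverse_pair K.+1 f g.
Let p := g K.
Let f1 := del_pos K p f.
Let g1 := del_val K p g.

Lemma delK_le : p <= K.
Proof. by have := inverse_pair_lt (x := K) (inverse_pair_sym H) (ltnSn K);
  rewrite -/p; lia. Qed.

Lemma del_at : f p = K. Proof. by case: H => _ gK _; apply: gK. Qed.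

Lemma del_at_inj x : f x = K -> x = p.
Proof. by case: H => fK _ _ e; rewrite /p -e fK. Qed.

Lemma g_neqp v : v < K -> g v != p.
Proof. by case: H => _ gK _ vK; apply/eqP => /(congr1 f); rewrite del_at gK; lia. Qed.

Lemma del_inverse_pair : inverse_pair K f1 g1.
Proof.
have := delK_le; case: (H) => fK gK fx pK; split=> x; rewrite /f1 /g1 /del_pos /del_val.
- case: (ltnP x K) => xK; last by rewrite ltnNge xK.
  have b : bump p x < K.+1 by rewrite /bump; lia.
  have : f (bump p x) != K by apply/eqP => /del_at_inj; rewrite /bump; lia.
  move=> ne; have := inverse_pair_lt H b => lt.
  have -> : f (bump p x) < K by lia.
  by rewrite fK bumpK.
- case: (ltnP x K) => xK; last by rewrite ltnNge xK.
  have ne := g_neqp xK.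
  have ? : g x < K.+1 by apply: (inverse_pair_lt (inverse_pair_sym H)); lia.
  have -> : unbump p (g x) < K by rewrite /unbump; lia.
  by rewrite unbumpKcond (negPf ne) add0n gK.
- by move=> Kx; rewrite ltnNge Kx.
Qed.

(** The largest value [K], at position [p], forms an inversion with each of the [K - p] later
    positions and with no earlier one. *)
Lemma ninv_del : ninv K.+1 f = ninv K f1 + (K - p).
Proof.
have pK := delK_le; pose P := Ordinal (pK : p < K.+1).
have lf (x : 'I_K) : f (bump p x) < K.
  have b : bump p x < K.+1 by rewrite /bump; have := ltn_ord x; lia.
  have : f (bump p x) != K by apply/eqP => /del_at_inj; rewrite /bump; lia.
  by have := inverse_pair_lt H b; lia.
rewrite /ninv (bigD1_ord P) //= addnC; congr (_ + _).
  apply: eq_bigr => x _; rewrite (bigD1_ord P) //= del_at.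
  rewrite (_ : K < _ = false) ?andbF ?add0n; last by have := lf x; lia.
  apply: eq_bigr => y _; rewrite /f1 /del_pos !ltn_ord; congr (nat_of_bool (_ && _)).
  by rewrite /bump; lia.
rewrite (bigD1_ord P) //= ltnn add0n del_at.
under eq_bigr => y _ do rewrite lf andbT.
rewrite -sum_geq; apply: eq_bigr => y _; rewrite /bump.
by case: (leqP p y) => /=; lia.
Qed.

(** For [j <= K] the position [p] never counts, its value being [K]; removing it shifts [i] exactly
    when it lies among the first [i] positions. *)
Lemma brank_del i j : j <= K -> i <= K.+1 -> brank f i j = brank f1 (i - (p < i)) j.
Proof.
move=> jK; have pK := delK_le; elim: i => [|i IH] iK; first by rewrite /brank !big_ord0.
have := IH (ltnW iK); rewrite /brank [in X in _ -> X = _]big_ord_recr /= => ->.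
case: (ltnP i p) => [ip|]; last rewrite leq_eqVlt => /orP[/eqP <-|pi].
- have [-> [-> iK1]] : (p < i) = false /\ (p < i.+1) = false /\ i < K by lia.
  by rewrite !subn0 big_ord_recr /= /f1 /del_pos iK1 /bump (leqNgt p) ip.
- by rewrite ltnn ltnSn subn0 subn1 /= del_at ltnNge jK addn0.
- case: i pi iK {IH} => // i pi iK;
    rewrite pi (leqW pi) !subn1 /= big_ord_recr /= /f1 /del_pos.
  by rewrite (iK : i < K) /bump (pi : p <= i).
Qed.

Lemma pmax_f_lo a : a < p -> pmax f a = pmax f1 a.
Proof.
have := delK_le => pK ap; apply: eq_pmax => x xa; rewrite /f1 /del_pos /bump.
by have [-> ->] : x < K /\ (p <= x) = false by lia.
Qed.

Lemma pmax_f_hi a : a <= K -> p <= a -> pmax f a = K.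
Proof.
move=> aK pa; have := pmax_ge f pa; rewrite del_at.
by have := pmax_lt H (aK : a < K.+1); lia.
Qed.

Lemma pmax_f_lt a : a < p -> pmax f a < K.
Proof.
have := delK_le => pK ap; rewrite pmax_f_lo //; apply: (pmax_lt del_inverse_pair); lia.
Qed.

(** On arguments below [K] the function [g] avoids [p], so it is [bump p] after [g1], and the
    monotone [bump p] commutes with maxima. *)
Lemma pmax_g v : v < K -> pmax g v = bump p (pmax g1 v).
Proof.
move=> vK.
have e w : w <= v -> g w = bump p (g1 w).
  move=> wv; have wK : w < K by lia.
  by rewrite /g1 /del_val wK unbumpKcond (negPf (g_neqp wK)) add0n.
apply/eqP; rewrite eqn_leq; apply/andP; split.
  by apply: pmax_le => w wv; rewrite (e _ wv) leq_bump2; apply: pmax_ge.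
have [w wv <-] := pmax_ex g1 v; rewrite -e //; exact: pmax_ge.
Qed.

End Deletion.

(** * Smooth permutations and their profiles *)

(** These properties characterise the pairs of prefix maxima of a smooth permutation and its inverse
    ([smooth_profile], [profile_exists]); [prof_S] is condition (S). *)
Record profile k (M M' : nat -> nat) : Prop := Profile {
  prof_ge : forall a, a < k -> (a <= M a < k) /\ (a <= M' a < k);
  prof_mono : forall a b, a <= b -> b < k -> (M a <= M b) /\ (M' a <= M' b);
  prof_fix : forall a, a < k -> (M a = a <-> M' a = a);
  prof_S : forall a, a < k ->
    (M' a <= M a -> M (M' a) = M a) /\ (M a <= M' a -> M' (M a) = M' a)
}.

Lemma profile_sym k M M' : profile k M M' -> profile k M' M.
Proof.
case=> h1 h2 h3 h4; split=> [a /h1[]|a b ab /(h2 _ _ ab)[]|a /h3[]|a /h4[]]; by split.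
Qed.

(** If [p <= M' a] with [a < q], then (S) either gives [M a = M (M' a) = K], so [p <= a], or gives
    [M' (M a) = M' a] with [a < M a < q], and the same failure recurs at [M a]. *)
Lemma profile_low K M M' p q : profile K.+1 M M' ->
  p <= K -> q <= p ->
  (forall a, a <= K -> M a = K <-> p <= a) ->
  (forall a, a <= K -> M' a = K <-> q <= a) ->
  (forall a, a < K -> M' a != p) ->
  forall a, a < q -> M' a < p.
Proof.
move=> [h1 h2 h3 h4] pK qp hp hq ne a aq.
have [d] := ubnP (q - a); elim: d a aq => // d IH a aq ad.
rewrite ltnNge; apply/negP => pa; have aK : a < K by lia.
have := ne a aK; have := hq a (ltnW aK); have := hp a (ltnW aK); have := h1 a (ltnW aK).
have := h4 a (ltnW aK).
case: (leqP (M' a) (M a)) => c [s1 s2] b hp' hq' ne'.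
  have := hp (M' a); have := s1 isT; lia.
have {s1 s2}s := s2 (ltnW c).
have := hq (M a); have := h3 a; have := IH (M a); lia.
Qed.

Lemma pmax_profile_base k f g : inverse_pair k f g ->
  (forall a, a < k -> (pmax g a <= pmax f a -> pmax f (pmax g a) = pmax f a) /\
                      (pmax f a <= pmax g a -> pmax g (pmax f a) = pmax g a)) ->
  profile k (pmax f) (pmax g).
Proof.
move=> H S; have H' := inverse_pair_sym H; split=> // a.
- by move=> ak; rewrite (pmax_id a H) (pmax_id a H') (pmax_lt H) // (pmax_lt H').
- by move=> b ab bk; split; apply: pmax_mono.
- by move=> ak; split; [apply: (pmax_fix H)|apply: (pmax_fix H')].
Qed.

Definition nsmooth k f g := ninv k f = ntransp k f g.

Lemma nsmooth_sym k f g : inverse_pair k f g -> nsmooth k f g <-> nsmooth k g f.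
Proof. by move=> H; rewrite /nsmooth (ninv_sym H) ntransp_sym. Qed.

Lemma sum_eq_pointwise k (F G : nat -> nat) : (forall a, a < k -> F a <= G a) ->
  (\sum_(a < k) F a <= \sum_(a < k) G a) /\
  ((\sum_(a < k) F a = \sum_(a < k) G a) <-> forall a, a < k -> F a = G a).
Proof.
move=> le; have := leqif_sum (I := 'I_k) (P := predT) (C := fun a : 'I_k => F a == G a)
  (E1 := fun a => F a) (E2 := fun a => G a).
move=> [|-> e]; first by move=> a _; split=> //; apply: le.
split=> //; split=> [/eqP|h].
  by rewrite e => /forallP h a ak; apply/eqP: (h (Ordinal ak)).
by apply: eq_bigr => a _; apply: h.
Qed.

(** * Smoothness under deletion *)

Section DeletionSmooth.
Variables (K : nat) (f g : nat -> nat).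
Hypothesis H : inverse_pair K.+1 f g.
Let p := g K.
Let q := f K.
Hypothesis qp : q <= p.
Let f1 := del_pos K p f.
Let g1 := del_val K p g.
Let H1 : inverse_pair K f1 g1 := del_inverse_pair H.
Let H' := inverse_pair_sym H.
Let H1' := inverse_pair_sym H1.

(** The summand [p <= a] accounts for T_{a,K}. For [p <= a] both prefix maxima are [K], as [q <= p],
    and exceed those after deletion; for smaller [a] deletion keeps the first one and cannot
    increase the second. *)
Lemma del_min_le a : a < K ->
  minn (pmax f1 a) (pmax g1 a) - a + (p <= a) <= minn (pmax f a) (pmax g a) - a.
Proof.
move=> aK; have := pmax_lt H1 aK; have := pmax_id a H1; have := pmax_id a H1'.
case: (leqP p a) => pa.
  rewrite (pmax_f_hi H (ltnW aK) pa) (pmax_f_hi H' (ltnW aK)) -/q; lia.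
rewrite (pmax_f_lo H pa) (pmax_g H aK) -/g1 -/p -/f1 /bump; lia.
Qed.

Lemma ntransp_del_aux : ntransp K f1 g1 + (K - p) =
  \sum_(a < K) (minn (pmax f1 a) (pmax g1 a) - a + (p <= a)).
Proof. by rewrite big_split /= sum_geq. Qed.

Lemma ntransp_last : ntransp K.+1 f g = \sum_(a < K) (minn (pmax f a) (pmax g a) - a).
Proof.
rewrite /ntransp big_ord_recr /=; have := pmax_lt H (ltnSn K); lia.
Qed.

Lemma ninv_le_del : ninv K f1 <= ntransp K f1 g1 -> ninv K.+1 f <= ntransp K.+1 f g.
Proof.
move=> le; rewrite (ninv_del H) -/p -/f1 ntransp_last.
have [h _] := sum_eq_pointwise del_min_le.
by apply: leq_trans h; rewrite -ntransp_del_aux; lia.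
Qed.

(** The bound on the length chains the one for the deleted permutation with the termwise
    [del_min_le], so equality holds in it exactly when it holds in both. *)
Lemma nsmooth_del : ninv K f1 <= ntransp K f1 g1 ->
  nsmooth K.+1 f g <-> nsmooth K f1 g1 /\
   forall a, a < K -> minn (pmax f1 a) (pmax g1 a) + (p <= a) =
     minn (pmax f a) (pmax g a).
Proof.
move=> le; rewrite /nsmooth (ninv_del H) -/p -/f1 ntransp_last.
have [h e] := sum_eq_pointwise del_min_le; rewrite -ntransp_del_aux in h e.
have lo a : a < K ->
  (a <= minn (pmax f1 a) (pmax g1 a)) && (a <= minn (pmax f a) (pmax g a)).
  move=> _; have := pmax_id a H; have := pmax_id a H1; have := pmax_id a H1';
    have := pmax_id a H'; lia.
split=> [eq|[eq h2]].
  have eq1 : ninv K f1 = ntransp K f1 g1 by lia.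
  split=> // a aK; have /e/(_ a aK) : ntransp K f1 g1 + (K - p) =
    \sum_(a < K) (minn (pmax f a) (pmax g a) - a) by lia.
  have := lo a aK; lia.
rewrite eq; apply/e => a aK; have := h2 a aK; have := lo a aK; lia.
Qed.

Lemma profile_del : profile K (pmax f1) (pmax g1) ->
  (forall a, a < K -> minn (pmax f1 a) (pmax g1 a) + (p <= a) =
    minn (pmax f a) (pmax g a)) ->
  profile K.+1 (pmax f) (pmax g).
Proof.
move=> [h1 h2 h3 h4] hm; have pK := delK_le H; apply: (pmax_profile_base H) => a aK.
case: (leqP p a) => pa.
  rewrite (pmax_f_hi H aK pa) (pmax_f_hi H' aK); last by rewrite -/q; lia.
  by rewrite (pmax_f_hi H (leqnn K) pK) (pmax_f_hi H' (leqnn K)) //;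
    apply: leq_trans pK.
have aK1 : a < K by rewrite -/p in pK; lia.
rewrite (pmax_f_lo H pa) (pmax_g H aK1) -/f1 -/g1 -/p.
have := hm a aK1; rewrite (pmax_f_lo H pa) (pmax_g H aK1) -/f1 -/g1 -/p.
have := h1 a aK1; have := h4 a aK1.
have := @pmax_f_lo K f g H (bump p (pmax g1 a)); rewrite -/p -/f1.
have := @pmax_g K f g H (pmax f1 a); rewrite -/p -/g1.
rewrite /bump.
(* If the bump moves [pmax g1 a], then [E] gives [pmax f1 a <= pmax g1 a], since otherwise the
   minimum would grow; only the second half of (S) is then at issue. *)
case: (leqP p (pmax g1 a)) => c A B [S1 S2] [D1 D2] E.
  rewrite A; last by lia.
  split; first by lia.
  move=> le; rewrite S2; lia.
rewrite add0n in B E *; rewrite B // A; last by lia.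
split=> // le; rewrite S2 //; lia.
Qed.
End DeletionSmooth.

Lemma ninv_le_ntransp k f g : inverse_pair k f g -> ninv k f <= ntransp k f g.
Proof.
elim: k f g => [|K IH] f g H; first by rewrite /ninv big_ord0.
wlog qp : f g H / f K <= g K.
  move=> W; case: (leqP (f K) (g K)) => c; first exact: W.
  by rewrite (ninv_sym H) ntransp_sym; apply: W (inverse_pair_sym H) _; apply: ltnW.
exact: (ninv_le_del H qp (IH _ _ (del_inverse_pair H))).
Qed.

Lemma smooth_profile k f g : inverse_pair k f g -> nsmooth k f g ->
  profile k (pmax f) (pmax g).
Proof.
elim: k f g => [|K IH] f g H s.
  by split=> // a b _; rewrite ltn0.
wlog qp : f g H s / f K <= g K.
  move=> W; case: (leqP (f K) (g K)) => c; first exact: W.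
  by apply: profile_sym; apply: W (inverse_pair_sym H) _ (ltnW c);
    apply/(nsmooth_sym H).
have H1 := del_inverse_pair H.
have [s1 hm] := (nsmooth_del H qp (ninv_le_ntransp H1)).1 s.
exact: (profile_del H qp (IH _ _ H1 s1) hm).
Qed.

(** Smoothness lets the domination pass to the permutations with [K] deleted, and [K] stands no
    earlier in [f2] than in [f], so the ranks compare by induction. *)
Lemma smooth_rank k f g f2 g2 : inverse_pair k f g -> nsmooth k f g ->
  inverse_pair k f2 g2 ->
  (forall y, y < k -> f2 y <= pmax f y /\ g2 y <= pmax g y) ->
  forall i j, i <= k -> j <= k -> brank f i j <= brank f2 i j.
Proof.
elim: k f g f2 g2 => [|K IH] f g f2 g2 H s H2 d.
  by move=> i j; rewrite leqn0 => /eqP-> _; rewrite /brank !big_ord0.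
wlog qp : f g f2 g2 H s H2 d / f K <= g K.
  move=> W; case: (leqP (f K) (g K)) => c; first exact: (W _ _ _ _ H s H2 d c).
  move=> i j ik jk; rewrite (brank_sym H ik jk) (brank_sym H2 ik jk).
  apply: (W _ _ _ _ (inverse_pair_sym H) _ (inverse_pair_sym H2) _ (ltnW c) _ _ jk ik).
    exact/(nsmooth_sym H).
  by move=> y /d[].
have H1 := del_inverse_pair H; have H' := inverse_pair_sym H;
  have H21 := del_inverse_pair H2.
have [s1 hm] := (nsmooth_del H qp (ninv_le_ntransp H1)).1 s.
have prof := smooth_profile H s.
have pK := delK_le H; have p2K := delK_le H2.
have hp a : a <= K -> pmax f a = K <-> g K <= a.
  move=> aK; split; last exact: (pmax_f_hi H aK).
  by move=> e; rewrite leqNgt; apply/negP => /(pmax_f_lt H); lia.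
have hq a : a <= K -> pmax g a = K <-> f K <= a.
  move=> aK; split; last exact: (pmax_f_hi H' aK).
  by move=> e; rewrite leqNgt; apply/negP => /(pmax_f_lt H'); lia.
have pne a : a < K -> pmax g a != g K.
  by move=> aK; have [w wa <-] := pmax_ex g a; apply: (g_neqp H); lia.
have low := profile_low prof pK qp hp hq pne.
(* The value [K] of [f2] at [g2 K] is dominated, so [pmax f] has reached [K] there. *)
have pp2 : g K <= g2 K.
  have := (d (g2 K) p2K).1; rewrite (del_at H2) => le.
  by apply/(hp _ p2K); have := pmax_lt H (p2K : g2 K < K.+1); lia.
have R := IH _ _ _ _ H1 s1 H21.
have {}R : forall i j, i <= K -> j <= K ->
  brank (del_pos K (g K) f) i j <= brank (del_pos K (g2 K) f2) i j.
  apply: R => y yK; split.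
    (* Below [g K] deletion changes nothing. From [g K] on, equality in [hm] makes the prefix
       maximum after deletion [K - 1], which bounds every value. *)
    case: (ltnP y (g K)) => yp.
      rewrite -(pmax_f_lo H yp); have := (d y (ltnW yK)).1.
      by rewrite /del_pos yK /bump (_ : (g2 K <= y) = false) ?add0n //; lia.
    have := inverse_pair_lt H21 yK; have := hm y yK; rewrite yp.
    have := pmax_f_hi H (ltnW yK) yp; have := pmax_f_hi H' (ltnW yK) (leq_trans qp yp).
    have := pmax_lt H1 yK; lia.
  have := pmax_g H yK; rewrite /del_val yK -/(del_val K (g K) g).
  have := (d y (ltnW yK)).2; have := pmax_lt H' (ltnW yK);
    have := inverse_pair_lt (inverse_pair_sym H2) (ltnW yK).
  (* Below [f K], [low] keeps the values under [g K <= g2 K], so none is renumbered; from [f K] on,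
     the prefix maximum is [K] before deletion and [K - 1] after it. *)
  case: (ltnP y (f K)) => yq.
    by have := low y yq; rewrite /bump /unbump; lia.
  have := pmax_f_hi H' (ltnW yK) yq; have := g_neqp H2 yK;
    have := pmax_lt (inverse_pair_sym H1) yK.
  rewrite /bump /unbump; lia.
move=> i j ik; rewrite leq_eqVlt => /orP[/eqP ->|jK].
  apply: leq_sum => x _; rewrite (inverse_pair_lt H2) ?leq_b1 //.
  exact: leq_trans (ltn_ord x) ik.
rewrite (brank_del H) // (brank_del H2) //.
(* As [g K <= g2 K], the index for [f2] is shifted down by no more than that for [f], and ranks grow
   with the index. *)
apply: leq_trans (R _ _ _ jK) _; first by lia.
rewrite [leqRHS](_ : _ = brank (del_pos K (g2 K) f2)
  (i - (g K < i) + ((g K < i) - (g2 K < i))) j); last first.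
  by congr brank; lia.
by rewrite /brank big_split_ord /=; apply: leq_addr.
Qed.

(** * Realising a profile by a smooth permutation *)

Lemma first_max K M : M K = K -> (forall a b, a <= b -> b <= K -> M a <= M b <= K) ->
  exists2 p, p <= K & forall a, a <= K -> M a = K <-> p <= a.
Proof.
move=> MK mono; have ex : exists a, M a == K by exists K; rewrite MK.
case: (ex_minnP ex) => p /eqP Mp minp.
have pK : p <= K by apply: minp; rewrite MK.
exists p => // a aK; split=> [/eqP/minp //|pa].
by have := mono _ _ pa aK; lia.
Qed.

(** For an abstract profile this replaces the fact that an inverse takes the value [p] only at [K].
    If [M' a = p], then (S) either forces [M a = K], hence [a = p] and [M' p = K], or gives
    [a < M a < p] with [M' (M a) = p], and the argument restarts at [M a]. *)
Lemma profile_skip K M M' p q : profile K.+1 M M' -> p <= K -> q <= p ->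
  (forall a, a <= K -> M a = K <-> p <= a) ->
  (forall a, a <= K -> M' a = K <-> q <= a) ->
  forall a, a < K -> M' a != p.
Proof.
move=> [h1 h2 h3 h4] pK qp hp hq a; have [d] := ubnP (K - a).
elim: d a => // d IH a ad aK; apply/eqP => e.
have := hp a; have := hq a; have := hp p; have := h3 a; have := h1 a.
have := h4 a (ltnW aK); rewrite e.
case: (leqP p (M a)) => c [s1 s2] b b1 b2 b3 b4.
  have := s1 isT; lia.
have := s2 (ltnW c); have := IH (M a); lia.
Qed.

(** Deleting the largest value of a smooth permutation caps its prefix maxima at [K - 1], so this is
    the profile to realise before [K] is inserted. *)
Lemma profile_trunc K M M' : profile K.+1 M M' ->
  profile K (fun a => minn (M a) K.-1) (fun a => minn (M' a) K.-1).
Proof.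
move=> [h1 h2 h3 h4]; split=> a.
- by move=> aK; have := h1 a (ltnW aK); lia.
- by move=> b ab bK; have := h2 _ _ ab (ltnW bK); lia.
- by move=> aK; have := h3 a (ltnW aK); have := h1 a (ltnW aK); lia.
- move=> aK; have aK1 := ltnW aK; have [s1 s2] := h4 a aK1; have [b1 b2] := h1 a aK1.
  have mono c : c < K -> a <= c -> M a <= M c /\ M' a <= M' c.
    by move=> cK ac; apply: h2 => //; apply: ltnW.
  split=> /= le.
    case: (leqP K.-1 (M a)) => c; first by case: (mono (minn (M' a) K.-1)); lia.
    have e : minn (M' a) K.-1 = M' a by lia.
    by rewrite e s1; lia.
  case: (leqP K.-1 (M' a)) => c; first by case: (mono (minn (M a) K.-1)); lia.
  have e : minn (M a) K.-1 = M a by lia.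
  by rewrite e s2; lia.
Qed.

Definition ins_pos K p (f : nat -> nat) x :=
  if x == p then K else if x <= K then f (unbump p x) else x.
Definition ins_val K p (g : nat -> nat) v :=
  if v < K then bump p (g v) else if v == K then p else v.

Lemma ins_inverse_pair K p f g : inverse_pair K f g -> p <= K ->
  inverse_pair K.+1 (ins_pos K p f) (ins_val K p g).
Proof.
move=> H pK; have H' := inverse_pair_sym H; case: (H) => fK gK fx; split=> x;
  rewrite /ins_pos /ins_val.
- case: eqP => [->|/eqP xp]; first by rewrite ltnn eqxx.
  case: (leqP x K) => xK; last by rewrite ltnNge (ltnW xK) gtn_eqF.
  have u : unbump p x < K by rewrite /unbump; lia.
  by rewrite (inverse_pair_lt H u) fK unbumpKcond (negPf xp).
- case: (ltnP x K) => xK.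
    rewrite eq_sym (negPf (neq_bump _ _)) bumpK gK.
    by have gx := inverse_pair_lt H' xK; have -> : bump p (g x) <= K by rewrite /bump;
      lia.
  case: (x =P K) => [->|ne]; first by rewrite eqxx.
  have [-> ->] // : (x == p) = false /\ (x <= K) = false by lia.
- by move=> Kx; have [-> ->] : (x == p) = false /\ (x <= K) = false by lia.
Qed.

Lemma del_ins_pos K p f g : inverse_pair K f g -> del_pos K p (ins_pos K p f) =1 f.
Proof.
move=> [_ _ fx] x; rewrite /del_pos /ins_pos; case: ltnP => [xK|/fx //].
rewrite eq_sym (negPf (neq_bump _ _)) bumpK.
by have -> : bump p x <= K by rewrite /bump; lia.
Qed.

Lemma del_ins_val K p f g : inverse_pair K f g -> del_val K p (ins_val K p g) =1 g.
Proof.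
move=> /inverse_pair_sym[_ _ gx] x; rewrite /del_val /ins_val;
  case: ltnP => [xK|/gx //].
by rewrite bumpK.
Qed.

Lemma eq_nsmooth k f f' g g' : f =1 f' -> g =1 g' -> nsmooth k f g -> nsmooth k f' g'.
Proof.
move=> ef eg; rewrite /nsmooth => s; transitivity (ninv k f).
  by apply: eq_bigr => x _; apply: eq_bigr => y _; rewrite !ef.
rewrite s; apply: eq_bigr => x _.
by rewrite (@eq_pmax f f') // (@eq_pmax g g').
Qed.

(** This reverses the deletion: the truncated profile is realised by induction, and [K] is inserted
    at the first point [p] where [M] reaches [K], after an inversion if [M'] reaches it later. *)
Lemma profile_exists k M M' : profile k M M' -> exists f g,
  [/\ inverse_pair k f g, nsmooth k f g,
      forall a, a < k -> pmax f a = M a & forall a, a < k -> pmax g a = M' a].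
Proof.
elim: k M M' => [|K IH] M M' prof.
  by exists id, id; split=> //; rewrite /nsmooth /ninv /ntransp !big_ord0.
have [h1 h2 h3 h4] := prof.
have [p pK hp] : exists2 p, p <= K & forall a, a <= K -> M a = K <-> p <= a.
  apply: first_max => [|a b ab bK]; first by have := h1 K; lia.
  by have := h2 a b ab bK; have := h1 b bK; lia.
have [q qK hq] : exists2 q, q <= K & forall a, a <= K -> M' a = K <-> q <= a.
  apply: first_max => [|a b ab bK]; first by have := h1 K; lia.
  by have := h2 a b ab bK; have := h1 b bK; lia.
wlog qp : M M' prof {h1 h2 h3 h4} p q pK hp qK hq / q <= p.
  move=> W; case: (leqP q p) => c; first exact: (W _ _ prof _ _ pK hp qK hq c).
  have [g [f [H s e1 e2]]] := W _ _ (profile_sym prof) _ _ qK hq pK hp (ltnW c).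
  by exists f, g; split=> //; [exact: inverse_pair_sym|apply/(nsmooth_sym H)].
have [h1 h2 h3 h4] := prof.
have low := profile_low prof pK qp hp hq (profile_skip prof pK qp hp hq).
(* If [p = K > 0], then [M (K - 1) = K - 1], and [prof_fix] gives the same for [M']. Hence wherever
   [M'] was capped at [K - 1], the insertion at [p] bumps it back to [K]. *)
have qpK : p = K -> q = K.
  case: {+}K h1 h3 hp hq qK pK {IH prof h2 h4 low} => [|L] h1 h3 hp hq qK pK pL;
    first by lia.
  have := hp L; have := hq L; have := h3 L; have := h1 L; lia.
have [f1 [g1 [H1 s1 e1 e2]]] := IH _ _ (profile_trunc prof).
have H := ins_inverse_pair H1 pK; set f := ins_pos K p f1 in H;
  set g := ins_val K p g1 in H.
have gK : g K = p by rewrite /g /ins_val ltnn eqxx.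
have d1 a : pmax (del_pos K p f) a = pmax f1 a by apply: eq_pmax => x _;
  apply: (del_ins_pos p H1).
have d2 a : pmax (del_val K p g) a = pmax g1 a by apply: eq_pmax => x _;
  apply: (del_ins_val p H1).
have fM a : a <= K -> pmax f a = M a.
  move=> aK; case: (ltnP a p) => ap.
    have := pmax_f_lo H (a := a); rewrite gK d1 => -> //.
    have aK1 : a < K by lia.
    have := hp a aK; have := h1 a aK; have := e1 a aK1; lia.
  have := pmax_f_hi H (a := a) aK; rewrite gK => -> //.
  by apply/esym/hp.
have gM a : a <= K -> pmax g a = M' a.
  rewrite leq_eqVlt => /orP[/eqP->|aK].
    by rewrite (pmax_f_hi (inverse_pair_sym H) (leqnn K)) ?(delK_le (inverse_pair_sym
      H)) //; apply/esym/hq.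
  have := pmax_g H aK; rewrite gK d2 => ->; rewrite e2 // /bump.
  have := hq a (ltnW aK); have := low a; have := h1 a (ltnW aK); lia.
have fK : f K <= g K.
  by rewrite gK leqNgt; apply/negP => /(pmax_f_lt (inverse_pair_sym H));
    rewrite gM //; have := hq p pK; lia.
exists f, g; split=> //.
have H1' := del_inverse_pair H; apply/(nsmooth_del H fK (ninv_le_ntransp H1'));
  rewrite gK; split.
  by apply: eq_nsmooth s1 => x; rewrite ?(del_ins_pos p H1) ?(del_ins_val p H1).
move=> a aK; rewrite d1 d2 e1 // e2 // (fM a (ltnW aK)) (gM a (ltnW aK)).
have := hq a (ltnW aK); have := hp a (ltnW aK); have := h1 a (ltnW aK); lia.
Qed.

(* At the largest [a] violating the bound, [R^-1_(a,c,e)] with [c = pmax g2 a] and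
   [e] as large as possible forces, by (S), a violation at [c > a]. *)
Lemma dominated_of_cycles N f g f2 g2 : inverse_pair N f2 g2 ->
  profile N (pmax f) (pmax g) ->
  (forall a, a < N -> minn (pmax f2 a) (pmax g2 a) = minn (pmax f a) (pmax g a)) ->
  (forall a c e, a < c -> c < e -> e < N ->
     e <= pmax f2 a -> c <= pmax g2 a -> e <= pmax g2 c -> e <= pmax f a) ->
  forall a, a < N -> pmax f2 a <= pmax f a.
Proof.
move=> H2 [h1 h2 h3 h4] hm hR a; have H2' := inverse_pair_sym H2.
have [d] := ubnP (N - a); elim: d a => // d IH a ad aN.
rewrite leqNgt; apply/negP => lt.
have hma := hm a aN; have := pmax_lt H2 aN; have := pmax_id a H2';
  have := pmax_fix H2' aN.
have := h1 a aN => ba; set c := pmax g2 a => fx ca lN.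
have ec : c = minn (pmax f a) (pmax g a) by lia.
have ac : a < c by rewrite ltn_neqAle ca andbT; apply/eqP => e; have := fx (esym e);
  lia.
have cN : c < N := pmax_lt H2' aN.
have mf := pmax_mono f2 (ltnW ac).
have IHc : pmax f2 c <= pmax f c by apply: IH => //; lia.
have := hR a c (minn (pmax f2 a) (pmax g2 c)) ac; have [S _] := h4 a aN.
have := pmax_id c H2'; have := pmax_fix H2' cN; have := pmax_lt H2' cN; have := hm c cN.
move=> hmc lc fc ic R.
have ltc : c < minn (pmax f2 a) (pmax g2 c).
  have ne : c <> pmax g2 c by move=> e; have := fc (esym e); lia.
  by lia.
have {}R : minn (pmax f2 a) (pmax g2 c) <= pmax f a by apply: R => //; lia.
have gc : pmax g a = c by lia.
by rewrite gc in S; have := S ltac:(lia); lia.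
Qed.

(** * Profiles from admissible sets *)

(** The consequences of downward closure for the transpositions [T] and one kind [R] of 3-cycles.
    Both kinds obey the same rules, so inversion merely exchanges [R] and [R'] below. *)
Record ideal_rel (T : rel nat) (R : nat -> nat -> nat -> bool) : Prop := IdealRel {
  idT : forall a b c, R a b c -> T a b /\ T b c;
  idl : forall a a' b c, R a b c -> a <= a' -> a' < b -> R a' b c;
  idr : forall a b c c', R a b c -> b < c' -> c' <= c -> R a b c';
  idTR : forall a b c, T a c -> a < b -> b < c -> R a b c
}.

Record admissible_rel (N : nat) (T : rel nat) (R R' : nat -> nat -> nat -> bool)
  : Prop := AdmissibleRel {
  admT : forall a b, T a b -> a < b < N;
  admTs : forall a a' b b', T a b -> a <= a' -> a' < b' -> b' <= b -> T a' b';
  admR : ideal_rel T R;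
  admR' : ideal_rel T R';
  adm_i : forall a b c d, R a b d -> R' a c d -> T a d;
  adm_ii : forall a b c, T a b -> T b c -> R a b c || R' a b c
}.

Lemma adm_sym N T R R' : admissible_rel N T R R' -> admissible_rel N T R' R.
Proof.
case=> h1 h2 h3 h4 h5 h6; split=> // [a b c d x y|a b c x y]; first exact: h5 y x.
by rewrite orbC h6.
Qed.

(** The [maxn a] supplies the value [a] when no T_{a,b} is present. *)
Definition reach N (T : rel nat) a := maxn a (\max_(b < N | T a b) b).

(** Testing the middle point [reach N T a] suffices: by [R_top], a cycle from [a] that ends beyond
    it also occurs with this middle point. *)
Definition extends N T (R : nat -> nat -> nat -> bool) a :=
  [exists e : 'I_N, R a (reach N T a) e].

(* Each step strictly increases [a] (see [extends_lt]), so fuel [N] is enough. *)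
Fixpoint climb N T R k a :=
  if k is k'.+1 then
    if extends N T R a then climb N T R k' (reach N T a) else reach N T a
  else reach N T a.

Definition climb_max N T R a := climb N T R N a.

Section Reach.
Variables (N : nat) (T : rel nat) (R R' : nat -> nat -> nat -> bool).
Hypothesis A : admissible_rel N T R R'.
Local Notation m := (reach N T).
Local Notation P := (extends N T R).

Lemma reach_ge a : a <= m a. Proof. exact: leq_maxl. Qed.

Lemma reach_lt a : a < N -> m a < N.
Proof.
move=> aN; rewrite /reach gtn_max aN /=; case: N aN => // n _.
by rewrite ltnS; apply/bigmax_leqP => i _; rewrite -ltnS.
Qed.

Lemma reachP a b : a < b -> T a b = (b <= m a).
Proof.
move=> ab; apply/idP/idP => [t|].
  have /andP[_ bN] := admT A t.
  by rewrite /reach leq_max (bigmax_sup (Ordinal bN)) ?orbT.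
rewrite /reach leq_max (leqNgt b a) ab /= => le.
case: (boolP [exists i : 'I_N, T a i && (b <= i)]) =>
  [/existsP[i /andP[Ti bi]]|/existsPn no].
  exact: (admTs A Ti).
suff le' : \max_(b < N | T a b) b <= b.-1 by have := leq_trans le le'; lia.
by apply/bigmax_leqP => i Ti; have := no i; rewrite Ti /=; lia.
Qed.

Lemma reach_mono a b : a <= b -> m a <= m b.
Proof.
move=> ab; case: (leqP (m a) b) => c; first exact: leq_trans c (reach_ge b).
rewrite -reachP //; apply: (admTs A (a := a) (b := m a)) => //.
by rewrite reachP // (leq_ltn_trans ab).
Qed.

Lemma relR_lt a b c : R a b c -> [&& a < b, b < c & c < N].
Proof.
by move=> /(idT (admR A))[/(admT A)/andP[-> _] /(admT A)/andP[-> ->]].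
Qed.

Lemma extendsP a : reflect (exists e, R a (m a) e) (P a).
Proof.
apply: (iffP existsP) => [[e h]|[e h]]; first by exists (val e).
by have /and3P[_ _ eN] := relR_lt h; exists (Ordinal eN).
Qed.

Lemma extends_lt a : P a -> a < m a < m (m a).
Proof.
move=> /extendsP[e h]; have /and3P[lt l _] := relR_lt h; rewrite lt.
by apply: (leq_trans l); rewrite -(reachP l); case: (idT (admR A) h).
Qed.

End Reach.

Section ClimbMax.
Variables (N : nat) (T : rel nat) (R R' : nat -> nat -> nat -> bool).
Hypothesis A : admissible_rel N T R R'.
Let A' := adm_sym A.
Local Notation m := (reach N T).
Local Notation P := (extends N T R).
Local Notation P' := (extends N T R').
Local Notation M := (climb_max N T R).

(** Two opposite cycles, cut by [idr] to the smaller of their last points, would give by (i) a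
    transposition from [a] beyond [m a]. *)
Lemma extends_excl a : P a -> ~~ P' a.
Proof.
move=> /(extendsP A)[e h]; apply/negP => /(extendsP A')[e' h'].
have /and3P[_ l _] := relR_lt A h; have /and3P[am l' _] := relR_lt A' h'.
have : T a (minn e e').
  apply: (adm_i A (b := m a) (c := m a)).
    by apply: (idr (admR A) h); lia.
  by apply: (idr (admR' A) h'); lia.
rewrite (reachP A); lia.
Qed.

(* [R a b e] and [R' a (m a) e] would give [T a e] by condition (i). *)
Lemma R_top a b e : R a b e -> m a < e -> R a (m a) e.
Proof.
move=> h me; have /and3P[ab be eN] := relR_lt A h; have [t1 t2] := idT (admR A) h.
have bm : b <= m a by rewrite -(reachP A).
have am : a < m a by apply: leq_trans bm.
have /orP[//|h'] : R a (m a) e || R' a (m a) e.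
  apply: (adm_ii A); first by rewrite (reachP A).
  exact: (admTs A t2).
by have := adm_i A h h'; rewrite (reachP A) ?(ltn_trans ab be) // leqNgt me.
Qed.

Lemma extends_or a : a < m a -> m a < m (m a) -> P a || P' a.
Proof.
move=> am mm; have : R a (m a) (m (m a)) || R' a (m a) (m (m a)).
  by apply: (adm_ii A); rewrite (reachP A).
case/orP=> h; [have -> : P a|have -> : P' a]; rewrite ?orbT //.
  by apply/(extendsP A); exists (m (m a)).
by apply/(extendsP A'); exists (m (m a)).
Qed.

Lemma climb_fuel k a : a < N -> N - a <= k -> climb N T R k.+1 a = climb N T R k a.
Proof.
elim: k a => [|k IH] a aN ak; first by lia.
rewrite [LHS]/= [RHS]/= -/(climb N T R k.+1 (reach N T a)); case: ifP => // h.
have := extends_lt A h; have mN := reach_lt T aN => mm.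
by rewrite -IH //; lia.
Qed.

Lemma climb_max_ext a : a < N -> P a -> M a = M (m a).
Proof.
move=> aN h; have := extends_lt A h; have mN := reach_lt T aN => mm.
rewrite /M /climb_max -(climb_fuel aN) ?leq_subr //= h.
by [].
Qed.

Lemma climb_max_neq a : ~~ P a -> M a = m a.
Proof. by move=> /negPf h; rewrite /M /climb_max; case: N h => //= n ->. Qed.

Lemma climb_max_bounds a : a < N -> m a <= M a < N.
Proof.
have [d] := ubnP (N - a); elim: d a => // d IH a ad aN; have := reach_lt T aN;
  move=> mN.
case h : (P a); last by rewrite climb_max_neq ?h // leqnn.
have := extends_lt A h; rewrite (climb_max_ext aN h) => lt; have := IH (m a); lia.
Qed.

Lemma extends_down a b : P a -> a <= b -> b < m a -> m b = m a -> P b.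
Proof.
move=> /(extendsP A)[e h] ab bm e1; apply/(extendsP A); exists e; rewrite e1.
exact: (idl (admR A) h).
Qed.

(** The critical case is [a < b < c < m b] with [c = m a], where [a] extends and [b] does not; then
    [M b = m b], and (i) and (ii) have to bound [M c] by it. *)
Lemma climb_max_mono a b : a <= b -> b < N -> M a <= M b.
Proof.
have [d] := ubnP (N - a); elim: d a b => // d IH a b ad ab bN.
have aN : a < N by lia.
have mab := reach_mono A ab.
have bb := climb_max_bounds bN; have mN := reach_lt T aN.
case Pa : (P a); last by rewrite climb_max_neq ?Pa //; lia.
have lt := extends_lt A Pa; rewrite (climb_max_ext aN Pa); set c := m a in lt mN *.
case: (leqP c b) => cb; first by apply: IH => //; lia.
case: (eqVneq (m b) c) => [e|ne].
  by rewrite (climb_max_ext bN (extends_down Pa ab cb e)) e.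
have cd : c < m b by lia.
have mdN := reach_lt T bN.
have mbc := reach_mono A (ltnW cb).
case Pb : (P b); first by rewrite (climb_max_ext bN Pb); apply: IH => //; lia.
rewrite (climb_max_neq (negbT Pb)).
have mcd := reach_mono A (ltnW cd).
have [e h] := extendsP A a Pa; rewrite -/c in h.
(* Only [R] can occur from [a] through [c], so (ii) yields it there, and [idl] moves the first point
   up to [b]. *)
have Rbc x : c < x -> x <= m c -> R b c x.
  move=> cx xm; have T1 : T a c by rewrite (reachP A); lia.
  have T2 : T c x by rewrite (reachP A); lia.
  have /orP[hx|hx] := adm_ii A T1 T2; first by apply: (idl (admR A) hx).
  have Pa' : P' a by apply/(extendsP A'); exists x.
  by have := extends_excl Pa; rewrite Pa'.
have cN : c < N by [].
(* If [m b < m c], then [b] extends through [R'], and this cycle together with [Rbc] gives by (i) a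
   transposition from [b] beyond [m b]. *)
case: (ltnP (m b) (m c)) => dm.
  have mm : m b < m (m b) by lia.
  have := extends_or _ mm; rewrite Pb /= => /(_ ltac:(lia)) /(extendsP A')[x hx].
  have /and3P[_ l _] := relR_lt A' hx.
  have : T b (minn x (m c)).
    apply: (adm_i A (b := c) (c := m b)); first by apply: Rbc; lia.
    by apply: (idr (admR' A) hx); lia.
  by rewrite (reachP A); lia.
have ec : m c = m b by lia.
(* An extension of [c] through [R] would make [b] extend through [R']; [idl] moves that cycle to
   [c], against exclusivity. *)
case: (boolP (P c)) => [Pc|/climb_max_neq->]; last by rewrite ec.
have ltc := extends_lt A Pc; rewrite ec in ltc.
have := extends_or (a := b);
  rewrite Pb /= => /(_ ltac:(lia) ltac:(lia)) /(extendsP A')[x hx].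
have P'c : P' c by apply/(extendsP A'); exists x; rewrite ec;
  apply: (idl (admR' A) hx); lia.
by have := extends_excl Pc; rewrite P'c.
Qed.

End ClimbMax.

Section ClimbMaxPair.
Variables (N : nat) (T : rel nat) (R R' : nat -> nat -> nat -> bool).
Hypothesis A : admissible_rel N T R R'.
Let A' := adm_sym A.
Local Notation m := (reach N T).
Local Notation P := (extends N T R).
Local Notation P' := (extends N T R').
Local Notation M := (climb_max N T R).
Local Notation M' := (climb_max N T R').

Variant climb_max_cases a : nat -> nat -> bool -> bool -> Prop :=
  | ClimbR of a < m a < m (m a) : climb_max_cases a (M (m a)) (m a) true false
  | ClimbR' of a < m a < m (m a) : climb_max_cases a (m a) (M' (m a)) false true
  | ClimbN of m (m a) = m a : climb_max_cases a (m a) (m a) false false.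

Lemma climb_maxP a : a < N -> climb_max_cases a (M a) (M' a) (P a) (P' a).
Proof.
move=> aN; case Pa : (P a).
  have nP := extends_excl A Pa;
    rewrite (negPf nP) (climb_max_ext A aN Pa) (climb_max_neq nP).
  by constructor; apply: (extends_lt A).
rewrite (climb_max_neq (negbT Pa)); case P'a : (P' a).
  by rewrite (climb_max_ext A' aN P'a); constructor; apply: (extends_lt A').
rewrite (climb_max_neq (negbT P'a)); constructor.
have := extends_or A (a := a); rewrite Pa P'a /= => no.
have := reach_ge N T a; have := reach_ge N T (m a).
rewrite leq_eqVlt => /orP[/eqP // |lt]; rewrite leq_eqVlt => /orP[/eqP e|lt2];
  first by rewrite -!e.
by have := no lt2 lt.
Qed.

Lemma min_climb_max a : a < N -> minn (M a) (M' a) = m a.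
Proof.
move=> aN; have mN := reach_lt T aN.
have := climb_max_bounds A mN; have := climb_max_bounds A' mN;
  have := reach_ge N T (m a).
by case: (climb_maxP aN) => *; lia.
Qed.

Lemma climb_max_fix a : a < N -> M a = a -> M' a = a.
Proof.
move=> aN; have mN := reach_lt T aN.
have := climb_max_bounds A mN; have := climb_max_bounds A' mN;
  have := reach_ge N T (m a); have := reach_ge N T a.
by case: (climb_maxP aN) => *; lia.
Qed.

Lemma climb_max_S a : a < N -> M' a <= M a -> M (M' a) = M a.
Proof.
move=> aN; have mN := reach_lt T aN; have := climb_max_bounds A' mN;
  case: (climb_maxP aN) => //.
  by move=> *; lia.
move=> e _ _; case: (climb_maxP mN); rewrite ?e //; lia.
Qed.

(** If [c <= m a], the transposition T_{a,c} already yields the cycle. Beyond [m a], [R_top] shows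
    that a cycle makes [a] extend; conversely, an extension through [R] excludes [R'] from the
    alternative in (ii). *)
Lemma R_climb_max a b c : a < b -> b < c -> c < N ->
  R a b c = [&& b <= M' a, c <= M' b & c <= M a].
Proof.
move=> ab bc cN; have bN := ltn_trans bc cN; have aN := ltn_trans ab bN.
have mN := reach_lt T aN; have minb := min_climb_max bN; have mina := min_climb_max aN.
apply/idP/and3P => [h|[h1 h2 h3]].
  have [t1 t2] := idT (admR A) h; rewrite (reachP A) // in t1;
    rewrite (reachP A) // in t2.
  split; try lia.
  case: (leqP c (m a)) => [|mc]; first by lia.
  have Pa : P a by apply/(extendsP A); exists c; apply: (R_top A h mc).
  rewrite (climb_max_ext A aN Pa); have := climb_max_bounds A mN.
  have : T (m a) c by apply: (admTs A (idT (admR A) h).2) => //; lia.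
  by rewrite (reachP A) //; lia.
case: (leqP c (m a)) => [cm|mc].
  by apply: (idTR (admR A)) => //; rewrite (reachP A) //; lia.
have am : a < m a by case: (climb_maxP aN) mina h1 h3; lia.
have Pa : P a by case: (climb_maxP aN) h3 => //; lia.
have P'a := extends_excl A Pa.
have Mma := climb_max_ext A aN Pa; have M'a := climb_max_neq P'a.
have tab : T a b by rewrite (reachP A) //; lia.
(* Monotonicity carries the bound from [a] to [b]; with [c <= M' b] it gives [c <= m b]. *)
have MbP : c <= M b by apply: leq_trans (climb_max_mono A (ltnW ab) bN); lia.
have tbc : T b c by rewrite (reachP A) //; lia.
have /orP[//|h'] := adm_ii A tab tbc.
have : P' a by apply/(extendsP A'); exists c; apply: (R_top A' h' mc).
by rewrite (negPf P'a).
Qed.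

End ClimbMaxPair.

Lemma adm_profile N T R R' : admissible_rel N T R R' ->
  profile N (climb_max N T R) (climb_max N T R').
Proof.
move=> A; have A' := adm_sym A; split=> a.
- move=> aN; have := climb_max_bounds A aN; have := climb_max_bounds A' aN;
    have := reach_ge N T a; lia.
- by move=> b ab bN; split; [apply: (climb_max_mono A)|apply: (climb_max_mono A')].
- by move=> aN; split; [apply: (climb_max_fix A)|apply: (climb_max_fix A')].
- by move=> aN; split; [apply: (climb_max_S A)|apply: (climb_max_S A')].
Qed.

(** * Permutations of ['I_n] as functions on nat *)

Lemma brank_le f i j : brank f i j <= i.
Proof. by elim: i => [|i IH];
  rewrite /brank ?big_ord0 // big_ord_recr /= -[leqRHS]addn1 leq_add // leq_b1. Qed.

(** If [f2 y] exceeded [pmax f y], the rank of [f] at [(y + 1, f2 y)] would be full, and hence that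
    of [f2], which does not count [y]. *)
Lemma brank_pmax N f g f2 g2 : inverse_pair N f g -> inverse_pair N f2 g2 ->
  (forall i j, i <= N -> j <= N -> brank f i j <= brank f2 i j) ->
  forall y, y < N -> f2 y <= pmax f y.
Proof.
move=> H H2 le y yN; rewrite leqNgt; apply/negP => lt.
have := le y.+1 (f2 y) yN (ltnW (inverse_pair_lt H2 yN)).
have := brank_max f y (f2 y); rewrite lt => /eqP-> le2.
have : brank f2 y.+1 (f2 y) == y.+1 by rewrite eqn_leq brank_le.
by rewrite brank_max ltnNge pmax_ge.
Qed.

(* Holds for transpositions and 3-cycles: their ranks differ from those of the
   identity by at most 1, so that prefix maxima decide the Bruhat order. *)
Definition sparse (f : nat -> nat) :=
  forall x y i, x <= i -> y <= i -> i < f x -> i < f y -> x = y.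

Lemma sparse_rank N f g f2 g2 : inverse_pair N f g -> inverse_pair N f2 g2 ->
  sparse f2 -> sparse g2 ->
  (forall y, y < N -> f2 y <= pmax f y /\ g2 y <= pmax g y) ->
  forall i j, i <= N -> j <= N -> brank f i j <= brank f2 i j.
Proof.
move=> H H2 sf sg d i j iN jN.
wlog ij : f g f2 g2 H H2 sf sg d i j iN jN / i <= j.
  move=> W; case: (leqP i j) => c; first exact: (W _ _ _ _ H H2 sf sg d).
  rewrite (brank_sym H) // (brank_sym H2) //.
  by apply: (W _ _ _ _ (inverse_pair_sym H) (inverse_pair_sym H2)) => // [y /d[]|];
    rewrite ?(ltnW c).
case: i iN ij => [|i] iN ij; first by rewrite /brank !big_ord0.
case: (boolP [exists x : 'I_i.+1, j <= f2 x]) => [/existsP[x jx]|/existsPn no];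
  last first.
  suff /eqP -> : brank f2 i.+1 j == i.+1 by apply: brank_le.
  by rewrite brank_max; have [y yi <-] := pmax_ex f2 i;
    have := no (Ordinal (yi : y < i.+1)); rewrite -ltnNge.
have xi : x <= i by rewrite -ltnS.
have lt : brank f i.+1 j < i.+1.
  rewrite ltn_neqAle brank_le andbT brank_max -leqNgt.
  apply: leq_trans (pmax_mono f xi); apply: leq_trans jx _.
  by have [] := d x (leq_ltn_trans xi iN).
suff -> : brank f2 i.+1 j = i by [].
rewrite /brank (bigD1 x) //= ltnNge jx add0n.
rewrite (eq_bigr (fun=> 1)) ?sum1_card; first by rewrite cardC1 card_ord.
move=> y yx; apply/eqP; rewrite eqb1 ltnNge; apply: contra yx => jy; apply/eqP/val_inj.
have yi : y <= i by rewrite -ltnS.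
by apply: (sf _ _ i) => //=; apply: (leq_trans ij).
Qed.

Lemma rank_inj N f g f2 g2 : inverse_pair N f g -> inverse_pair N f2 g2 ->
  (forall i j, i <= N -> j <= N -> brank f i j = brank f2 i j) -> f =1 f2.
Proof.
move=> H H2 e x; case: (ltnP x N) => xN; last by case: H H2 => [_ _ ->] // [_ _ ->].
have b j : j <= N -> (f x < j) = (f2 x < j).
  move=> jN; have := e x.+1 j xN jN; rewrite /brank !big_ord_recr /= -!/(brank _ x j).
  by rewrite (e x j (ltnW xN) jN) => /addnI; case: (f x < j); case: (f2 x < j).
have := b _ (ltnW (inverse_pair_lt H xN)); have := b _ (ltnW (inverse_pair_lt H2 xN));
  lia.
Qed.

Section PermutationsAsFunctions.
Variable n : nat.
Local Notation N := n.+1.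
Implicit Types s t : 'S_N.

Definition natfun (s : 'S_N) x : nat := if x < N then nat_of_ord (s (inord x)) else x.

Lemma natfunE s (i : 'I_N) : natfun s i = s i.
Proof. by rewrite /natfun ltn_ord inord_val. Qed.

Lemma natfun_inverse_pair s : inverse_pair N (natfun s) (natfun s^-1).
Proof.
split=> x; rewrite /natfun; last by move=> Nx; rewrite ifN // -leqNgt.
  by case: (ltnP x N) => xN;
    [rewrite ltn_ord inord_val permK inordK|rewrite ifN // -leqNgt].
by case: (ltnP x N) => xN;
  [rewrite ltn_ord inord_val permKV inordK|rewrite ifN // -leqNgt].
Qed.

Lemma natfun_exists f g : inverse_pair N f g -> exists s,
  natfun s =1 f /\ natfun s^-1 =1 g.
Proof.
move=> H; case: (H) => fK gK fx.
have inj : injective (fun x : 'I_N => inord (f x) : 'I_N).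
  move=> x y /(congr1 val);
    rewrite /= !inordK ?(inverse_pair_lt H) // => /(can_inj fK); exact: val_inj.
exists (perm inj).
have e : natfun (perm inj) =1 f.
  move=> x; rewrite /natfun; case: ltnP => [xN|/fx //].
  by rewrite permE !inordK ?(inverse_pair_lt H).
split=> // x; have [_ K2 _] := natfun_inverse_pair (perm inj).
by rewrite -[in RHS](K2 x) e fK.
Qed.

Lemma card_initseg s (i j : 'I_N) :
  #|(s @: initseg i) :&: initseg j| = brank (natfun s) i.+1 j.+1.
Proof.
rewrite (_ : _ :&: _ = s @: [set x : 'I_N | (x < i.+1) && (natfun s x < j.+1)]).
  rewrite card_imset; last exact: perm_inj.
  rewrite (brankE (k := N)) // -sum1_card big_mkcond /=.
  by apply: eq_bigr => x _; rewrite inE; case: ifP.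
apply/setP=> y; rewrite !inE; apply/andP/imsetP => [[/imsetP[x xi ->] sj]|[x xi ->]].
  by exists x => //; rewrite !inE in xi *; rewrite natfunE !ltnS xi.
move: xi; rewrite !inE natfunE !ltnS => /andP[xi sj]; split=> //.
by apply/imsetP; exists x; rewrite ?inE.
Qed.

Lemma bruhatP t s : reflect
  (forall i j, i <= N -> j <= N -> brank (natfun s) i j <= brank (natfun t) i j)
  (bruhat t s).
Proof.
(* Ranks with [i = 0] or [j = 0] vanish; the others are shifted by one against the ordinals, as
   [initseg i] has [i + 1] elements. *)
apply: (iffP forallP) => [h [|i] [|j] iN jN|h i].
- by rewrite /brank !big_ord0.
- by rewrite /brank !big_ord0.
- by rewrite leq_eqVlt; apply/orP; left; apply/eqP/eq_bigr => x _; rewrite !ltn0.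
- have /forallP/(_ (Ordinal jN)) := h (Ordinal iN); by rewrite !card_initseg.
by apply/forallP => j; rewrite !card_initseg; apply: h.
Qed.

Lemma bruhat_pmax t s : bruhat t s ->
  forall y, y < N ->
    natfun t y <= pmax (natfun s) y /\ natfun t^-1 y <= pmax (natfun s^-1) y.
Proof.
move/bruhatP => h y yN; have Ht := natfun_inverse_pair t; have Hs := natfun_inverse_pair s; split.
  exact: (brank_pmax Hs Ht).
apply: (brank_pmax (inverse_pair_sym Hs) (inverse_pair_sym Ht)) => // i j iN jN.
by rewrite -(brank_sym Hs jN iN) -(brank_sym Ht jN iN) h.
Qed.

Lemma sparse_bruhat t s : sparse (natfun t) -> sparse (natfun t^-1) ->
  (forall y, y < N ->
     natfun t y <= pmax (natfun s) y /\ natfun t^-1 y <= pmax (natfun s^-1) y) ->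
  bruhat t s.
Proof.
by move=> h1 h2 h; apply/bruhatP;
  apply: sparse_rank (natfun_inverse_pair s) (natfun_inverse_pair t) h1 h2 h.
Qed.

Lemma bruhatV t s : bruhat t^-1 s^-1 = bruhat t s.
Proof.
have V (u v : 'S_N) : bruhat u v -> bruhat u^-1 v^-1.
  move=> /bruhatP h; apply/bruhatP => i j iN jN.
  by rewrite -(brank_sym (natfun_inverse_pair u) jN iN) -(brank_sym (natfun_inverse_pair v) jN iN) h.
by apply/idP/idP => /V; rewrite ?invgK.
Qed.

Lemma bruhat_trans t s r : bruhat t s -> bruhat s r -> bruhat t r.
Proof.
by move=> /bruhatP h1 /bruhatP h2; apply/bruhatP => i j iN jN;
  apply: leq_trans (h2 _ _ iN jN) (h1 _ _ iN jN).
Qed.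

Lemma bruhat_anti t s : bruhat t s -> bruhat s t -> t = s.
Proof.
move=> /bruhatP h1 /bruhatP h2; apply/permP => x; apply: val_inj; rewrite /= -!natfunE.
apply: (rank_inj (natfun_inverse_pair t) (natfun_inverse_pair s)) => i j iN jN.
by apply/eqP; rewrite eqn_leq h1 // h2.
Qed.

(** * Transpositions and 3-cycles in the Bruhat order *)

Lemma natfun_tperm a b : a < b -> b < N -> let t := tperm (inord a) (inord b) : 'S_N in
  forall x, natfun t x = if x == a then b else if x == b then a else x.
Proof.
move=> ab bN t x; rewrite /natfun /t; case: (ltnP x N) => xN;
  last by have [-> ->] : (x == a) = false /\ (x == b) = false by lia.
have aN : a < N by lia.
rewrite permE /= -!val_eqE /= !inordK //; case: ifP => _; first by rewrite inordK.
by case: ifP => _; rewrite inordK.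
Qed.

Local Notation rc a b c := (rcycle (inord a) (inord b) (inord c) : 'S_N).

Lemma natfun_rcycle a b c : a < b -> b < c -> c < N ->
  forall x, natfun (rc a b c) x =
    if x == a then b else if x == b then c else if x == c then a else x.
Proof.
move=> ab bc cN x; have bN := ltn_trans bc cN; have aN := ltn_trans ab bN.
rewrite /natfun; case: (ltnP x N) => xN; last first.
  by have [-> [-> ->]] : (x == a) = false /\ (x == b) = false /\ (x == c) =
    false by lia.
have [] := @rcycleE N (inord a) (inord b) (inord c); rewrite ?inordK // => e1 e2 e3 e4.
case: eqP => [->|xa]; first by rewrite e1 inordK.
case: eqP => [->|xb]; first by rewrite e2 inordK.
case: eqP => [->|xc]; first by rewrite e3 inordK.
rewrite e4 ?inordK // !inE -!val_eqE /= !inordK //; lia.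
Qed.

Lemma natfun_rcycleV a b c : a < b -> b < c -> c < N ->
  forall x, natfun (rc a b c)^-1 x =
    if x == a then c else if x == b then a else if x == c then b else x.
Proof.
move=> ab bc cN x; have [K K2 _] := natfun_inverse_pair (rc a b c).
apply: (can_inj K); rewrite K2 (natfun_rcycle ab bc cN).
case: (x =P a) => [->|xa];
  first by have [-> [-> ->]] : (c == a) = false /\ (c == b) = false /\ (c == c) =
    true by lia.
case: (x =P b) => [->|xb]; first by rewrite eqxx.
case: (x =P c) => [->|xc];
  first by have [-> ->] : (b == a) = false /\ (b == b) = true by lia.
by have [-> [-> ->]] : (x == a) = false /\ (x == b) = false /\ (x == c) = false by lia.
Qed.

Lemma bruhat_tperm a b s : a < b -> b < N ->
  bruhat (tperm (inord a) (inord b)) s =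
    (b <= pmax (natfun s) a) && (b <= pmax (natfun s^-1) a).
Proof.
move=> ab bN; have aN := ltn_trans ab bN; have e := natfun_tperm ab bN;
  have Hs := natfun_inverse_pair s.
apply/idP/andP => [/bruhat_pmax/(_ a aN)|[h1 h2]]; first by rewrite tpermV !e eqxx.
apply: sparse_bruhat; rewrite ?tpermV; last first.
  move=> y yN; rewrite !e; have := pmax_id y Hs;
    have := pmax_id y (inverse_pair_sym Hs).
  by case: eqP => [->|_] //; case: eqP => [->|] //; lia.
all: by move=> x y i; rewrite !e; do ![case: ifP]; lia.
Qed.

(** Domination is a condition only at points that are raised: [a] and [b] by the cycle, [a] by its
    inverse. Elsewhere it follows from [pmax_id]. *)
Lemma bruhat_rcycle a b c s : a < b -> b < c -> c < N ->
  bruhat (rc a b c) s =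
  [&& b <= pmax (natfun s) a, c <= pmax (natfun s) b & c <= pmax (natfun s^-1) a].
Proof.
move=> ab bc cN; have bN := ltn_trans bc cN; have aN := ltn_trans ab bN.
have e := natfun_rcycle ab bc cN; have e' := natfun_rcycleV ab bc cN;
  have Hs := natfun_inverse_pair s.
apply/idP/and3P => [/bruhat_pmax h|[h1 h2 h3]].
  have := h a aN; have := h b bN; rewrite !e !e' !eqxx gtn_eqF // => -[-> _] [-> ->] //.
apply: sparse_bruhat; last first.
  move=> y yN; rewrite e e'; have := pmax_id y Hs;
    have := pmax_id y (inverse_pair_sym Hs).
  case: (y =P a) => [->|_] //; case: (y =P b) => [->|_] //; first by lia.
  by case: (y =P c) => [->|_]; lia.
all: by move=> x y i; rewrite ?e ?e'; do ![case: ifP]; lia.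
Qed.

Lemma bruhat_rcycleV a b c s : a < b -> b < c -> c < N ->
  bruhat (rc a b c)^-1 s =
  [&& b <= pmax (natfun s^-1) a, c <= pmax (natfun s^-1) b & c <= pmax (natfun s) a].
Proof. by move=> ab bc cN; rewrite -bruhatV invgK bruhat_rcycle ?invgK. Qed.

End PermutationsAsFunctions.

(** * Cycles below a permutation *)

Section CyclesBelow.
Variable n : nat.
Local Notation N := n.+1.
Implicit Types (s t : 'S_N) (A : {set 'S_N}).
Local Notation tp a b := (tperm (inord a) (inord b) : 'S_N).
Local Notation rc a b c := (rcycle (inord a) (inord b) (inord c) : 'S_N).

Lemma in_C_23 s t : (t \in C_23 s) = (t \in cycles23 N) && bruhat t s.
Proof. by rewrite inE. Qed.

Lemma in_C_T s t : (t \in C_T s) = (t \in transpositions N) && bruhat t s.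
Proof. by rewrite inE. Qed.

Lemma perm_lengthE s : perm_length s = ninv N (natfun s).
Proof.
rewrite /perm_length /ninv pair_big -sum1_card big_mkcond /=.
by apply: eq_bigr => p _; rewrite inE !natfunE; case: ifP.
Qed.

Lemma sum_between K a b : \sum_(x < K) (a < x <= b) = minn K b.+1 - a.+1.
Proof. by elim: K => [|K IH]; rewrite ?big_ord0 // big_ord_recr /= IH; lia. Qed.

Lemma tperm_eq (T : finType) (a b c d : T) : a != b -> tperm a b = tperm c d ->
  (a = c /\ b = d) \/ (a = d /\ b = c).
Proof.
move=> ab e; have := tpermL a b; rewrite e.
case: tpermP => [<- <-|<- <-|_ _ /eqP]; [by left|by right|by rewrite (negPf ab)].
Qed.

Lemma transpositionsP t : reflect (exists a b, [/\ a < b, b < N & t = tp a b])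
  (t \in transpositions N).
Proof.
rewrite inE; apply: (iffP existsP) =>
  [[i /existsP[j /andP[ij /eqP->]]]|[a [b [ab bN ->]]]].
  by exists i, j; rewrite !inord_val.
exists (inord a); apply/existsP; exists (inord b); rewrite eqxx andbT !inordK //.
exact: ltn_trans bN.
Qed.

Lemma tp_cycles a b : a < b -> b < N -> tp a b \in cycles23 N.
Proof. by move=> ab bN; rewrite inE; apply/orP; left; apply/transpositionsP;
  exists a, b. Qed.

Lemma rc_cycles a b c : a < b -> b < c -> c < N ->
  (rc a b c \in cycles23 N) && ((rc a b c)^-1 \in cycles23 N).
Proof.
move=> ab bc cN; have bN := ltn_trans bc cN; have aN := ltn_trans ab bN.
by apply/andP; split; rewrite inE; apply/orP; right; rewrite inE;
  apply/existsP; exists (inord a); apply/existsP; exists (inord b); apply/existsP;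
    exists (inord c);
  rewrite !inordK // ab bc eqxx ?orbT.
Qed.

Lemma cycles23_ind (Q : 'S_N -> Prop) :
  (forall a b, a < b -> b < N -> Q (tp a b)) ->
  (forall a b c, a < b -> b < c -> c < N -> Q (rc a b c)) ->
  (forall a b c, a < b -> b < c -> c < N -> Q (rc a b c)^-1) ->
  forall t, t \in cycles23 N -> Q t.
Proof.
move=> hT hR hRV t; rewrite inE => /orP[/transpositionsP[a [b [ab bN ->]]]|];
  first exact: hT.
rewrite inE => /existsP[i /existsP[j /existsP[k /and3P[ij jk /orP[]/eqP->]]]].
  by have := hR i j k ij jk (ltn_ord k); rewrite !inord_val.
by have := hRV i j k ij jk (ltn_ord k); rewrite !inord_val.
Qed.

Lemma card_C_T s : #|C_T s| = ntransp N (natfun s) (natfun s^-1).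
Proof.
pose m a := minn (pmax (natfun s) a) (pmax (natfun s^-1) a).
pose B := [set p : 'I_N * 'I_N | p.1 < p.2 <= m p.1].
have -> : C_T s = (fun p => tperm p.1 p.2) @: B.
  apply/setP=> t; apply/idP/imsetP => [|[[i j] /=]].
    rewrite inE => /andP[/transpositionsP[a [b [ab bN ->]]]].
    rewrite bruhat_tperm // => le; have aN := ltn_trans ab bN.
    by exists (inord a, inord b) => //; rewrite inE /m /= !inordK // ab leq_min.
  rewrite inE /= /m leq_min => /andP[ij le] ->.
  have := @bruhat_tperm n i j s ij (ltn_ord j); rewrite !inord_val inE => ->.
  by rewrite le andbT; apply/transpositionsP; exists i, j; rewrite !inord_val.
rewrite card_in_imset; last first.
  move=> [i j] [k l]; rewrite !inE /= =>
    /andP[ij _] /andP[kl _] /tperm_eq[|[-> ->] //|[e1 e2]].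
    by rewrite -val_eqE /= ltn_eqF.
  by rewrite e1 e2 in ij; lia.
rewrite /ntransp -sum1_card big_mkcond /=.
rewrite (eq_bigr (fun p : 'I_N * 'I_N => nat_of_bool (p.1 < p.2 <= m p.1))); last first.
  by move=> p _; rewrite inE; case: ifP.
rewrite -(pair_big predT predT (fun i j : 'I_N => nat_of_bool (i < j <= m i))) /=.
apply: eq_bigr => i _; rewrite sum_between /m.
by have := pmax_lt (natfun_inverse_pair s) (ltn_ord i); lia.
Qed.

Lemma smoothP s : smooth s <-> nsmooth N (natfun s) (natfun s^-1).
Proof. by rewrite /smooth /nsmooth perm_lengthE card_C_T. Qed.

Definition inT A a b := [&& a < b, b < N & tp a b \in A].
Definition inR A a b c := [&& a < b, b < c, c < N & rc a b c \in A].
Definition inRV A a b c := [&& a < b, b < c, c < N & (rc a b c)^-1 \in A].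

Lemma pmax_from s x a b : x <= a -> b <= natfun s x -> b <= pmax (natfun s) a.
Proof. by move=> xa bx; apply: leq_trans bx (pmax_ge _ xa). Qed.

(** Each rule is a Bruhat comparison of two cycles, and every bound on a prefix maximum is witnessed
    by a single value of the larger cycle or its inverse. *)
Lemma ideal_R A : downward_closed A -> ideal_rel (inT A) (inR A).
Proof.
move=> D; split=> [a b c|a a' b c|a b c c'|a b c].
- move=> /and4P[ab bc cN h]; have bN := ltn_trans bc cN.
  have e := natfun_rcycle ab bc cN; have e' := natfun_rcycleV ab bc cN.
  split; apply/and3P; split=> //; apply: (D _ _ h);
    rewrite ?tp_cycles // bruhat_tperm //; apply/andP; split.
  + by apply: (pmax_from (x := a)); rewrite // e eqxx.
  + by apply: (pmax_from (x := a)); rewrite // e' eqxx ltnW.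
  + by apply: (pmax_from (x := b)); rewrite // e eqxx gtn_eqF.
  + by apply: (pmax_from (x := a)); rewrite ?(ltnW ab) // e' eqxx.
- move=> /and4P[ab bc cN h] aa ab'.
  have e := natfun_rcycle ab bc cN; have e' := natfun_rcycleV ab bc cN.
  apply/and4P; split=> //; apply: (D _ _ h); first by case/andP: (rc_cycles ab' bc cN).
  rewrite bruhat_rcycle //; apply/and3P; split.
  + by apply: (pmax_from (x := a)); rewrite // e eqxx.
  + by apply: (pmax_from (x := b)); rewrite // e eqxx gtn_eqF.
  + by apply: (pmax_from (x := a)); rewrite // e' eqxx.
- move=> /and4P[ab bc cN h] bc' cc.
  have cN' := leq_ltn_trans cc cN.
  have e := natfun_rcycle ab bc cN; have e' := natfun_rcycleV ab bc cN.
  apply/and4P; split=> //; apply: (D _ _ h); first by case/andP: (rc_cycles ab bc' cN').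
  rewrite bruhat_rcycle //; apply/and3P; split.
  + by apply: (pmax_from (x := a)); rewrite // e eqxx.
  + by apply: (pmax_from (x := b)); rewrite // e eqxx gtn_eqF.
  + by apply: (pmax_from (x := a)); rewrite // e' eqxx.
- move=> /and3P[ac cN h] ab bc.
  have e := natfun_tperm ac cN.
  apply/and4P; split=> //; apply: (D _ _ h); first by case/andP: (rc_cycles ab bc cN).
  rewrite bruhat_rcycle // tpermV; apply/and3P; split; apply: (pmax_from (x := a));
    rewrite ?e ?eqxx //; exact: ltnW.
Qed.

Lemma cycles23V t : (t^-1 \in cycles23 N) = (t \in cycles23 N).
Proof.
have V (u : 'S_N) : u \in cycles23 N -> u^-1 \in cycles23 N.
  move: u; apply: cycles23_ind => [a b ab bN|a b c ab bc cN|a b c ab bc cN];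
    rewrite ?invgK ?tpermV ?tp_cycles //;
  by case/andP: (rc_cycles ab bc cN).
by apply/idP/idP => /V; rewrite ?invgK.
Qed.

Definition invset A := [set t | t^-1 \in A].

(** Inversion preserves the Bruhat order and [cycles23], so [ideal_R] applies to the set of
    inverses. *)
Lemma ideal_RV A : downward_closed A -> ideal_rel (inT A) (inRV A).
Proof.
move=> D; have D' : downward_closed (invset A).
  by move=> s t; rewrite /invset in_set => sA tc ts; rewrite in_set;
    apply: (D _ _ sA); rewrite ?cycles23V ?bruhatV.
have [h1 h2 h3 h4] := ideal_R D'.
have eT a b : inT (invset A) a b = inT A a b by rewrite /inT inE tpermV.
have eR a b c : inR (invset A) a b c = inRV A a b c by rewrite /inR inE.
split=> [a b c|a a' b c|a b c c'|a b c]; rewrite -?eT -?eR;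
  [exact: h1|exact: h2|exact: h3|exact: h4].
Qed.

(* [pmax (natfun s)] goes with the inverse cycles, see [bruhat_rcycleV]. *)
Lemma admissible_adm A : admissible A -> admissible_rel N (inT A) (inRV A) (inR A).
Proof.
move=> [sub D ci cii]; split; [|  |exact: ideal_RV|exact: ideal_R| | ].
- by move=> a b /and3P[-> ->].
- move=> a a' b b' /and3P[ab bN h] aa ab' bb; have bN' := leq_ltn_trans bb bN.
  apply/and3P; split=> //; apply: (D _ _ h);
    rewrite ?tp_cycles // bruhat_tperm // tpermV.
  by have e := natfun_tperm ab bN; apply/andP; split; apply: (pmax_from (x := a));
    rewrite // e eqxx.
- move=> a b c d /and4P[ab bd dN h1] /and4P[ac cd _ h2].
  have [bN cN] := (ltn_trans bd dN, ltn_trans cd dN); have aN := ltn_trans ab bN.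
  apply/and3P; split=> //; first exact: ltn_trans bd.
  by apply: (ci _ (inord c) (inord b)) => //; rewrite !inordK.
- move=> a b c /and3P[ab bN h1] /and3P[bc cN h2]; have aN := ltn_trans ab bN.
  apply/orP; rewrite /inRV /inR ab bc cN /=.
  by case: (cii (inord a) (inord b) (inord c) _ _ h1 h2); rewrite ?inordK //;
    [right|left].
Qed.

Lemma smooth_admissible s : smooth s -> admissible (C_23 s).
Proof.
move=> /smoothP sm; have H := natfun_inverse_pair s;
  have [h1 h2 h3 h4] := smooth_profile H sm; split.
- by apply/subsetP => t; rewrite in_C_23 => /andP[].
- by move=> r t; rewrite !in_C_23 => /andP[_ rs] -> /bruhat_trans; apply.
- move=> i j k l ij jl ik kl; rewrite !in_C_23 => /andP[_ r1] /andP[_ r2]; apply/andP;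
    split.
    by have := @tp_cycles i l (ltn_trans ij jl) (ltn_ord l); rewrite !inord_val.
  have := @bruhat_rcycle n i j l s ij jl (ltn_ord l);
    rewrite !inord_val r1 => /esym/and3P[_ _ le1].
  have := @bruhat_rcycleV n i k l s ik kl (ltn_ord l);
    rewrite !inord_val r2 => /esym/and3P[_ _ le2].
  by have := @bruhat_tperm n i l s (ltn_trans ij jl) (ltn_ord l);
    rewrite !inord_val le1 le2 => ->.
- move=> i j k ij jk; rewrite !in_C_23 => /andP[_ t1] /andP[_ t2].
  have := @bruhat_tperm n i j s ij (ltn_ord j);
    rewrite !inord_val t1 => /esym/andP[f1 g1].
  have := @bruhat_tperm n j k s jk (ltn_ord k);
    rewrite !inord_val t2 => /esym/andP[f2 g2].
  have := rc_cycles ij jk (ltn_ord k); rewrite !inord_val => /andP[-> ->].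
  have := @bruhat_rcycle n i j k s ij jk (ltn_ord k); rewrite !inord_val => ->.
  have := @bruhat_rcycleV n i j k s ij jk (ltn_ord k); rewrite !inord_val => ->.
  rewrite f1 f2 g1 g2 /=; have [s1 s2] := h4 i (ltn_ord i).
  (* If the prefix maximum of [s] at [i] is the larger one, (S) equates it with the one at
     [pmax (natfun s^-1) i]. That point is at least [j], so [k] has been reached there. The other
     case is symmetric. *)
  case: (leqP (pmax (natfun s^-1) i) (pmax (natfun s) i)) => c; [right|left].
    by rewrite -(s1 c); apply: leq_trans f2 (pmax_mono _ g1).
  by rewrite -(s2 (ltnW c)); apply: leq_trans g2 (pmax_mono _ f1).
Qed.

(** Equality of the sets [C_T] fixes the smaller of the two prefix maxima at each point, the
    3-cycles then bound the larger one, and [smooth_rank] turns this domination into the Bruhat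
    order. *)
Lemma smooth_greatest s t : smooth s -> C_T t = C_T s -> C_23 t \subset C_23 s ->
  bruhat t s.
Proof.
move=> /smoothP sm eT /subsetP sub; have Hs := natfun_inverse_pair s;
  have Ht := natfun_inverse_pair t.
have prof := smooth_profile Hs sm.
have sub' r : r \in cycles23 N -> bruhat r t -> bruhat r s.
  by move=> rc rt; have := sub r; rewrite !in_C_23 rt andbT => /(_ rc)/andP[].
have em a : a < N -> minn (pmax (natfun t) a) (pmax (natfun t^-1) a) =
  minn (pmax (natfun s) a) (pmax (natfun s^-1) a).
  move=> aN; have e b : a < b -> b < N ->
    (b <= minn (pmax (natfun t) a) (pmax (natfun t^-1) a)) =
      (b <= minn (pmax (natfun s) a) (pmax (natfun s^-1) a)).
    move=> ab bN; rewrite !leq_min -!bruhat_tperm //.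
    have /setP/(_ (tp a b)) := eT; rewrite !in_C_T.
    have tpT : tp a b \in transpositions N by apply/transpositionsP; exists a, b.
    by rewrite tpT.
  have := pmax_id a Hs; have := pmax_id a Ht.
  have := pmax_id a (inverse_pair_sym Hs); have := pmax_id a (inverse_pair_sym Ht).
  have := pmax_lt Hs aN; have := pmax_lt Ht aN.
  (* Both minima are at least [a] and pass the same tests [b > a]; using each of them as [b] shows
     that they agree. *)
  have := e (minn (pmax (natfun t) a) (pmax (natfun t^-1) a)).
  have := e (minn (pmax (natfun s) a) (pmax (natfun s^-1) a)).
  lia.
have d1 : forall a, a < N -> pmax (natfun t) a <= pmax (natfun s) a.
  apply: (dominated_of_cycles Ht prof em) => a c e ac ce eN l1 l2 l3.
  have /andP[_ /sub'] := rc_cycles ac ce eN.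
  by rewrite !bruhat_rcycleV // l1 l2 l3 => /(_ isT)/and3P[].
have d2 : forall a, a < N -> pmax (natfun t^-1) a <= pmax (natfun s^-1) a.
  apply: (dominated_of_cycles (inverse_pair_sym Ht) (profile_sym prof)) =>
    [a aN|a c e ac ce eN l1 l2 l3].
    by rewrite minnC em // minnC.
  have /andP[/sub' + _] := rc_cycles ac ce eN.
  by rewrite !bruhat_rcycle // l1 l2 l3 => /(_ isT)/and3P[].
apply/bruhatP; apply: (smooth_rank Hs sm Ht) => y yN.
by split; [apply: leq_trans (d1 y yN)|apply: leq_trans (d2 y yN)]; apply: pmax_ge.
Qed.

(** The profile that [climb_max] extracts from [A] is realised by [profile_exists]; [min_climb_max]
    and [R_climb_max] then match the Bruhat criteria for the three kinds of cycles. *)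
Lemma admissible_smooth A : admissible A -> exists2 s, smooth s & C_23 s = A.
Proof.
move=> adA; have [sub D _ _] := adA; have ad := admissible_adm adA.
have ad' := adm_sym ad.
have [f [g [H sm ef eg]]] := profile_exists (adm_profile ad).
have [s [sf sg]] := natfun_exists H.
have {}ef a : a < N -> pmax (natfun s) a = climb_max N (inT A) (inRV A) a.
  by move=> aN; rewrite -ef //; apply: eq_pmax => x _; apply: sf.
have {}eg a : a < N -> pmax (natfun s^-1) a = climb_max N (inT A) (inR A) a.
  by move=> aN; rewrite -eg //; apply: eq_pmax => x _; apply: sg.
exists s; first by apply/smoothP; apply: eq_nsmooth sm => x; rewrite ?sf ?sg.
apply/setP=> t; rewrite in_C_23.
case tc : (t \in cycles23 N); last by apply/esym/negP => /(subsetP sub); rewrite tc.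
move: t tc; apply: cycles23_ind => [a b ab bN|a b c ab bc cN|a b c ab bc cN] /=.
- have aN := ltn_trans ab bN.
  by rewrite bruhat_tperm // ef // eg // -leq_min (min_climb_max ad aN) -(reachP ad)
    // /inT ab bN.
- have bN := ltn_trans bc cN; have aN := ltn_trans ab bN.
  have := R_climb_max ad' ab bc cN; rewrite /inR ab bc cN /= => ->.
  rewrite bruhat_rcycle // ef // ef // eg //.
- have bN := ltn_trans bc cN; have aN := ltn_trans ab bN.
  have := R_climb_max ad ab bc cN; rewrite /inRV ab bc cN /= => ->.
  rewrite bruhat_rcycleV // ef // eg // eg //.
Qed.

End CyclesBelow.

(** * The bijection and its inverse *)

Theorem theorem1p1 (n : nat) (n_ge1 : 1 <= n) :
  (forall s : 'S_n, smooth s -> admissible (C_23 s)) /\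
  (forall s t : 'S_n, smooth s -> smooth t -> C_23 s = C_23 t -> s = t) /\
  (forall A : {set 'S_n}, admissible A -> exists2 s, smooth s & C_23 s = A) /\
  (exists pi : {set 'S_n} -> 'S_n,
     (forall A : {set 'S_n}, admissible A -> smooth (pi A)) /\
     (forall A : {set 'S_n}, admissible A -> C_23 (pi A) = A) /\
     (forall s : 'S_n, smooth s -> pi (C_23 s) = s) /\
     (forall A : {set 'S_n}, admissible A ->
        is_greatest (fun t => C_23 t = A) (pi A) /\
        is_greatest (fun t => C_T t = A :&: transpositions n /\
                              C_23 t \subset A) (pi A))).
Proof.
case: n n_ge1 => // n _.
have CT (s : 'S_n.+1) : C_T s = C_23 s :&: transpositions n.+1.
  apply/setP=> t; rewrite in_C_T in_setI in_C_23 /cycles23 in_setU.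
  by case: (t \in transpositions _); rewrite ?andbF ?andbT.
have greatest (s t : 'S_n.+1) : smooth s -> C_T t = C_23 s :&: transpositions n.+1 ->
    C_23 t \subset C_23 s -> bruhat t s.
  by rewrite -CT; apply: smooth_greatest.
have inj (s t : 'S_n.+1) : smooth s -> smooth t -> C_23 s = C_23 t -> s = t.
  by move=> ss st e; apply: bruhat_anti; apply: greatest; rewrite ?CT ?e.
split; first exact: smooth_admissible.
split=> //; split; first exact: admissible_smooth.
(* The default [1] is taken only if no smooth permutation has the set [A], which [piP] excludes for
   admissible [A]. *)
pose pi (A : {set 'S_n.+1}) :=
  odflt 1%g [pick s : 'S_n.+1 | (perm_length s == #|C_T s|) && (C_23 s == A)].
have piP A : admissible A -> smooth (pi A) /\ C_23 (pi A) = A.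
  move=> /admissible_smooth[s ss sA]; rewrite /pi;
    case: pickP => [t /andP[/eqP st /eqP tA] //|].
  by move=> /(_ s); rewrite sA ss !eqxx.
exists pi; split; first by move=> A /piP[].
split; first by move=> A /piP[].
split=> [s ss|A /piP[ss sA]].
  by have [sp ep] := piP _ (smooth_admissible ss); apply: inj.
split; split=> //.
(* Permutations with [C_23 t = A] also satisfy the weaker condition of the second maximum. *)
- by move=> t tA; apply: greatest; rewrite ?CT ?sA ?tA.
- by rewrite CT sA.
- by move=> t [tT tA]; apply: greatest; rewrite ?sA.
Qed.
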